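(* Let $n\ge 2$. There exists a compact set $E\subset\mathbb{R}^n$ of Hausdorff dimension $n/2$ such that $E$ does not contain three distinct points forming the angle $\pi/2$. Moreover, $E$ does not contain four distinct points $x,y,z,v$ such that $x-y$ and $z-v$ are orthogonal.
   Context: Three distinct points $x,y,z\in\mathbb{R}^n$ form the angle $\alpha$ if, for some labelling of them, the angle $\angle yxz\in[0,\pi]$ at the vertex $x$ between the vectors $y-x$ and $z-x$ equals $\alpha$. *)

(* Defs.v *)
From mathcomp Require Import all_boot all_order all_algebra.
From mathcomp Require Import all_classical all_reals all_analysis.

Set Implicit Arguments.
Unset Strict Implicit.
Unset Printing Implicit Defensive.

Import Order.TTheory GRing.Theory Num.Theory.
Import numFieldNormedType.Exports.

Local Open Scope classical_set_scope.
Local Open Scope ring_scope.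

(* The library norm on ['rV[R]_n] is the sup norm; distances and angles below
   are Euclidean. The library topology on ['rV[R]_n], used by [compact], is the
   product topology, hence the usual one. *)
Definition dot (R : realType) (n : nat) (u v : 'rV[R]_n) : R :=
  \sum_(i < n) u ord0 i * v ord0 i.

Definition enorm (R : realType) (n : nat) (u : 'rV[R]_n) : R :=
  Num.sqrt (dot u u).

(* The angle at the vertex [x], in [0, pi]; meaningful for [y != x], [z != x]. *)
Definition angle (R : realType) (n : nat) (y x z : 'rV[R]_n) : R :=
  acos (dot (y - x) (z - x) / (enorm (y - x) * enorm (z - x))).

Definition form_angle (R : realType) (n : nat) (alpha : R)
    (x y z : 'rV[R]_n) : Prop :=
  uniq [:: x; y; z] /\
  exists a b c : 'rV[R]_n,
    perm_eq [:: a; b; c] [:: x; y; z] /\ angle b a c = alpha.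

Definition orthogonal_vec (R : realType) (n : nat) (u v : 'rV[R]_n) : Prop :=
  dot u v = 0.

(* The value on [set0] is -oo, so that [set0] satisfies every diameter bound. *)
Definition diam (R : realType) (n : nat) (A : set 'rV[R]_n) : \bar R :=
  ereal_sup [set (enorm (x - y))%:E | x in A & y in A].

(* diam(A)^s with the conventions 0^0 = 1 and diam(set0)^s = 0, also for
   s = 0. *)
Definition diam_pow (R : realType) (n : nat) (s : R) (A : set 'rV[R]_n) :
    \bar R :=
  if A == set0 then 0%E else poweR (diam A) s.

Definition delta_cover (R : realType) (n : nat) (delta : R)
    (A : set 'rV[R]_n) (U : nat -> set 'rV[R]_n) : Prop :=
  A `<=` \bigcup_i U i /\ forall i, (diam (U i) <= delta%:E)%E.

Definition hausdorff_premeasure (R : realType) (n : nat) (s delta : R)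
    (A : set 'rV[R]_n) : \bar R :=
  ereal_inf [set (\sum_(0 <= i <oo) diam_pow s (U i))%E
            | U in delta_cover delta A].

Definition hausdorff_measure (R : realType) (n : nat) (s : R)
    (A : set 'rV[R]_n) : \bar R :=
  ereal_sup [set hausdorff_premeasure s delta A | delta in [set d : R | 0 < d]].

Definition hausdorff_dim (R : realType) (n : nat) (A : set 'rV[R]_n) : \bar R :=
  ereal_inf [set s%:E | s in [set s : R | 0 <= s /\ hausdorff_measure s A = 0%E]].

(* Main.v *)
Require Import Defs.
From mathcomp Require Import all_boot all_order all_algebra.
From mathcomp Require Import all_classical all_reals all_analysis.
From mathcomp Require Import zify ring lra.

Set Implicit Arguments.
Unset Strict Implicit.
Unset Printing Implicit Defensive.

Import Order.TTheory GRing.Theory Num.Theory.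
Import numFieldNormedType.Exports.

(* The set consists of the points of the unit cube whose coordinates have binary
   digits of two kinds.  Outside of the blocks of positions [p, 2 p + c), for a
   rapidly increasing sequence of values of [p], the digits are free (apart from
   a sparse sequence of zeros); inside the blocks they are zero, with one
   exception below.  Half of the digits are free at the end of each block, and
   at least about half of them everywhere, whence the dimension [n / 2]: the
   prefixes give efficient covers, and reading off the free digits gives a map
   onto [0, 1) that is Hoelder of any exponent less than [n / 2].  Up to errors
   of order [2^-(2 p + c)] the coordinates are multiples of [2^-p], so that
   [(x - y) . (z - v)] is nearly a multiple of [2^-(2 p)].  Inside the block a
   single digit is set to 1, in one coordinate [j] and for the points [x] with a
   given prefix only; its position is such that this shifts the product by a
   non-integral multiple of [2^-(2 p)], provided that [z_j - v_j] has a given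
   order of magnitude.  The blocks run through all choices of the prefix, [j] and
   this order of magnitude. *)

(** * Finite bit strings read as integers *)

Fixpoint nat_of_bits (d : nat -> bool) (m : nat) : nat :=
  if m is m'.+1 then (nat_of_bits d m').*2 + d m' else 0.

Lemma eq_nat_of_bits (d d' : nat -> bool) (m : nat) :
  (forall q, q < m -> d q = d' q) -> nat_of_bits d m = nat_of_bits d' m.
Proof.
elim: m => //= m IH h; rewrite h // IH // => q qm; apply: h; exact: ltnW.
Qed.

Lemma nat_of_bits_inj (d d' : nat -> bool) (m : nat) :
  nat_of_bits d m = nat_of_bits d' m -> forall q, q < m -> d q = d' q.
Proof.
elim: m => //= m IH h q; rewrite ltnS leq_eqVlt.
have [h1 h2] : nat_of_bits d m = nat_of_bits d' m /\ d m = d' m.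
  by move: h; case: (d m); case: (d' m) => /=; lia.
by case/orP => [/eqP-> //|]; exact: IH.
Qed.

Lemma ltn_nat_of_bits (d : nat -> bool) (m : nat) : nat_of_bits d m < 2 ^ m.
Proof. by elim: m => //= m IH; rewrite expnS; case: (d m) => /=; lia. Qed.

Lemma nat_of_bits_zeros (d : nat -> bool) (a b : nat) : a <= b ->
  (forall q, a <= q < b -> d q = false) ->
  nat_of_bits d b = nat_of_bits d a * 2 ^ (b - a).
Proof.
move=> /subnKC <-; move: (b - a) => k; rewrite addKn.
elim: k => [|k IH] h; first by rewrite addn0 muln1.
rewrite addnS /= IH ?expnS; last by move=> q hq; apply: h; lia.
rewrite h; last by lia.
by rewrite addn0 -mul2n; lia.
Qed.

(** * Blocks, spacers and the digits of the points *)

Fixpoint block_length (c k : nat) : nat :=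
  if k is k'.+1 then block_length c k' + ((block_length c k' + 2) ^ 2 + c)
  else 0.

(** [block_length c k] is the total length of the blocks before block [k]. Since block [k] starts at
    about the square of it, those blocks fill only about a square root of the positions before
    it. *)
Definition block_start (c k : nat) : nat := (block_length c k + 2) ^ 2.

Definition block_end (c k : nat) : nat := (block_start c k).*2 + c.

(** The bound on [k] makes the predicate boolean and loses nothing, because [k < block_start c k];
    likewise in [digit]. *)
Definition in_block (c q : nat) : bool :=
  [exists k : 'I_q.+1, block_start c k <= q < block_end c k].

(** Quadratic growth makes the spacers negligible in number, yet dense enough that consecutive ones
    are only of order [sqrt q] apart. They are odd while marked positions are even, so that they
    carry the digit zero inside blocks as well. *)
Definition spacer (q : nat) : bool := [exists r : 'I_q, q == (2 * r ^ 2).+1].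

Definition is_free (c q : nat) : bool := ~~ spacer q && ~~ in_block c q.

Definition free_rank (c q : nat) : nat := count (is_free c) (iota 0 q).

(** The 2-adic valuation takes each value infinitely often, so every triple (prefix, coordinate,
    order of magnitude) is the task of infinitely many blocks. *)
Definition task (k : nat) : option (seq bool * nat * nat) := unpickle (logn 2 k).

(** With [p = block_start c k], the digit at [q = 2 p + 2 - 2 m] has weight [2^-(q + 1)], that is,
    [4^m / 8] times [2^-(2 p)]. Multiplied by a difference of size between [4^-m] and [4^(1 - m)],
    it gives between 1/8 and 1/2 of [2^-(2 p)]. *)
Definition marked (n c : nat) (b : nat -> bool) (k i q : nat) : bool :=
  if task k is Some (u, j, m) then
    [&& i == j, q + m.*2 == (block_start c k).*2 + 2
      & prefix u (mkseq b (n * free_rank c (block_start c k)))]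
  else false.

(** Each free position takes [n] consecutive bits of [b], one per coordinate, so the first
    [n * free_rank c q] bits are those placed before [q]. *)
Definition digit (n c : nat) (b : nat -> bool) (i q : nat) : bool :=
  if is_free c q then b (n * free_rank c q + i)
  else [exists k : 'I_q.+1,
         (block_start c k <= q < block_end c k) && marked n c b k i q].

Lemma leq_block_length (c k : nat) : k <= block_length c k.
Proof. by elim: k => //= k IH; rewrite expnS; nia. Qed.

Lemma ltn_block_start (c k : nat) : k < block_start c k.
Proof. have := leq_block_length c k; rewrite /block_start expnS expn1; nia. Qed.

Lemma block_end_le (c k k' : nat) : k < k' -> block_end c k <= block_start c k'.
Proof.
elim: k' => // k' IH; rewrite ltnS leq_eqVlt => h.
have step : block_end c k' <= block_start c k'.+1.
  rewrite /block_end /block_start /=; set a := block_length c k'.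
  set b := (a + 2) ^ 2; rewrite expnS expn1; nia.
case/orP: h => [/eqP-> //|/IH h].
by apply: leq_trans h (leq_trans _ step); rewrite /block_end -addnn; lia.
Qed.

Lemma block_inj (c k k' q : nat) : block_start c k <= q < block_end c k ->
  block_start c k' <= q < block_end c k' -> k = k'.
Proof.
move=> /andP[h1 h2] /andP[h3 h4].
by case: (ltngtP k k') => // /(block_end_le c); lia.
Qed.

Lemma in_blockP (c q : nat) :
  reflect (exists k, block_start c k <= q < block_end c k) (in_block c q).
Proof.
apply: (iffP existsP) => [[k hk]|[k hk]]; first by exists k.
have kq : k < q.+1 by have := ltn_block_start c k; lia.
by exists (Ordinal kq).
Qed.

Lemma spacerP (q : nat) : reflect (exists r, q = (2 * r ^ 2).+1) (spacer q).
Proof.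
apply: (iffP existsP) => [[r /eqP hr]|[r hr]]; first by exists r.
have rq : r < q by rewrite hr; nia.
by exists (Ordinal rq); apply/eqP.
Qed.

(** * Density of the free positions *)

Lemma leq_free_rank (c p q : nat) : p <= q -> free_rank c p <= free_rank c q.
Proof. by move=> /subnKC <-; rewrite /free_rank iotaD count_cat leq_addr. Qed.

Lemma free_rankS (c q : nat) : free_rank c q.+1 = free_rank c q + is_free c q.
Proof. by rewrite /free_rank -addn1 iotaD count_cat /= addn0. Qed.

Lemma free_rank_onto (c p l : nat) : l < free_rank c p ->
  exists q, [/\ q < p, is_free c q & free_rank c q = l].
Proof.
elim: p => // p IH; rewrite free_rankS.
case: (ltnP l (free_rank c p)) => [/IH[q [h1 h2 h3]] _|h].
  by exists q; split=> //; exact: ltnW.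
case hf: (is_free c p) => /= h'; last by lia.
by exists p; split=> //; lia.
Qed.

Lemma count_spacer (r : nat) : count spacer (iota 0 (2 * r ^ 2).+1) <= r.
Proof.
rewrite -size_filter -{2}(size_iota 0 r) -(size_map (fun r => (2 * r ^ 2).+1) (iota 0 r)).
apply: uniq_leq_size; first by apply: filter_uniq; exact: iota_uniq.
move=> q; rewrite mem_filter mem_iota add0n => /and3P[/spacerP[s ->] _ h].
by apply: map_f; rewrite mem_iota; nia.
Qed.

(* The blocks before the last one that starts below [p] have total length at
   most [sqrt p], and this last one covers at most [(p + c) / 2] of the
   positions below [p]. *)
Lemma count_in_block (c r : nat) :
  2 * count (in_block c) (iota 0 (2 * r ^ 2).+1) <= 2 * (2 * r + 1) + (2 * r ^ 2).+1 + c.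
Proof.
set p := (2 * r ^ 2).+1.
(* The positions counted are injected into a list made of the first [K] blocks and [x] positions
   from the start of block [K]. *)
have cover K x : (forall q, q < p -> in_block c q ->
    exists k, k < K /\ block_start c k <= q < block_end c k \/
              block_start c K <= q < block_start c K + x) ->
  count (in_block c) (iota 0 p) <= block_length c K + x.
  move=> h.
  pose s k :=
    flatten [seq iota (block_start c j) (block_start c j + c) | j <- iota 0 k].
  have szs k : size (s k) = block_length c k.
    elim: k => // k IH; rewrite /s -addn1 iotaD map_cat flatten_cat size_cat IH.
    by rewrite addn1 /= cats0 size_iota.
  rewrite -szs -(size_iota (block_start c K) x) -size_cat -size_filter.
  apply: uniq_leq_size; first by apply: filter_uniq; exact: iota_uniq.
  move=> q; rewrite mem_filter mem_iota add0n => /and3P[hq _ qp].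
  rewrite mem_cat; have [k [[kK hk]|hk]] := h q qp hq; apply/orP; [left|right].
    apply/flattenP; exists (iota (block_start c k) (block_start c k + c)).
      by apply: map_f; rewrite mem_iota.
    by rewrite mem_iota; move: hk; rewrite /block_end; lia.
  by rewrite mem_iota.
have [K hK] : exists K, p < block_start c K by exists p; exact: ltn_block_start.
case: (ex_minnP (ex_intro (fun K => p < block_start c K) K hK)) => {hK}[[|k]] hk kmin.
  suff : count (in_block c) (iota 0 p) <= block_length c 0 + 0 by move=> /=; lia.
  apply: cover => q qp /in_blockP[j hj]; exists j; left.
  case: j hj => [|j] hj; first by lia.
  by have := @block_end_le c 0 j.+1 isT; rewrite /block_end; lia.
have hkp : block_start c k <= p.
  by rewrite leqNgt; apply/negP => /kmin; rewrite ltnn.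
(* The minimum is at most the mean [(p + c) / 2] of its two arguments. *)
have h1 : count (in_block c) (iota 0 p)
    <= block_length c k + minn (p - block_start c k) (block_start c k + c).
  apply: cover => q qp /in_blockP[j hj]; exists j.
  case: (ltngtP j k) => jk; first by left.
    have : block_start c k.+1 <= block_start c j.
      move: jk; rewrite leq_eqVlt => /orP[/eqP<- //|/(block_end_le c)].
      by rewrite /block_end; lia.
    by lia.
  right; rewrite -jk; move: hj; rewrite /block_end; lia.
have h2 : block_length c k <= 2 * r + 1.
  move: hkp; rewrite /block_start /p; nia.
by lia.
Qed.

(** A position that is not free is a spacer or lies in a block; subtracting both counts leaves half
    of the positions, up to a loss linear in [r], of the order of the square root of the number of
    positions. *)
Lemma free_rank_ge (c r : nat) :
  2 * r ^ 2 <= 2 * free_rank c (2 * r ^ 2).+1 + 6 * r + c + 1.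
Proof.
set p := (2 * r ^ 2).+1.
have h : p <= free_rank c p + (count spacer (iota 0 p) + count (in_block c) (iota 0 p)).
  rewrite -count_predUI; set s := iota 0 p.
  apply: (@leq_trans (free_rank c p + count (predU spacer (in_block c)) s)); last by lia.
  rewrite -{1}(size_iota 0 p) -(count_predC (is_free c)) leq_add2l.
  by apply: sub_count => q /=; rewrite /is_free -negb_or negbK.
have := count_spacer r; have := count_in_block c r; rewrite -/p; lia.
Qed.

Lemma free_rank_unbounded (c M : nat) :
  exists K, forall k, K <= k -> M <= free_rank c (block_start c k).
Proof.
exists (2 * (M + c + 4) ^ 2).+1 => k hk.
have := free_rank_ge c (M + c + 4).
have := @leq_free_rank c _ _ (leq_trans hk (ltnW (ltn_block_start c k))).
nia.
Qed.

(** * Digits at spacers, inside blocks and up to the end of a block *)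

Lemma digit_spacer (n c : nat) (b : nat -> bool) (i r : nat) :
  digit n c b i (2 * r ^ 2).+1 = false.
Proof.
rewrite /digit /is_free; have -> /= : spacer (2 * r ^ 2).+1 by apply/spacerP; exists r.
apply/existsP => -[k] /andP[_]; rewrite /marked; case: task => // -[[u j] m].
by case/and3P => _ /eqP h _; lia.
Qed.

Lemma digit_block (n c : nat) (b : nat -> bool) (i k q : nat) :
  block_start c k <= q < block_end c k -> digit n c b i q = marked n c b k i q.
Proof.
move=> hq; rewrite /digit /is_free; have -> : in_block c q by apply/in_blockP; exists k.
rewrite andbF; apply/existsP/idP => [[j /andP[hj]]|h]; first by rewrite (block_inj hj hq).
have kq : k < q.+1 by have := ltn_block_start c k; lia.
by exists (Ordinal kq); rewrite hq.
Qed.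

(** Block [k] has no free position, and its mark depends only on bits placed before it. The bits
    known at [block_start] thus fix the digits about twice as far, which is what makes the covers
    efficient. *)
Lemma digit_local (n c : nat) (b b' : nat -> bool) (i k : nat) : i < n ->
  (forall l, l < n * free_rank c (block_start c k) -> b l = b' l) ->
  forall q, q < block_end c k -> digit n c b i q = digit n c b' i q.
Proof.
move=> ni hb q hq; rewrite /digit; case hf: (is_free c q).
  apply: hb; have qk : q < block_start c k.
    rewrite ltnNge; apply/negP => h; move: hf; rewrite /is_free.
    by have -> : in_block c q by [apply/in_blockP; exists k; rewrite h]; rewrite andbF.
  have : free_rank c q.+1 <= free_rank c (block_start c k) by exact: leq_free_rank.
  by rewrite free_rankS hf; nia.
apply: eq_existsb => j.
case hj: (block_start c j <= q < block_end c j) => //=.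
have jk : j <= k by rewrite leqNgt; apply/negP => /(block_end_le c); lia.
rewrite /marked; case: task => // -[[u a] m]; congr [&& _, _ & prefix _ _].
apply/eq_in_map => l; rewrite mem_iota => hl; apply: hb.
have jk' : block_start c j <= block_start c k.
  move: jk; rewrite leq_eqVlt => /orP[/eqP-> //|/(block_end_le c)].
  by rewrite /block_end; lia.
have := leq_free_rank c jk'; nia.
Qed.

Lemma task_recurrent (t : seq bool * nat * nat) (K : nat) :
  exists2 k, K <= k & task k = Some t.
Proof.
(* The odd factor leaves the valuation at [pickle t] and pushes the index beyond [K]. *)
exists (2 ^ pickle t * (2 * K).+1).
  have := expn_gt0 2 (pickle t); nia.
rewrite /task lognM ?expn_gt0 // pfactorK //.
rewrite (_ : logn 2 (2 * K).+1 = 0) ?addn0 ?pickleK //.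
apply: logn_coprime; rewrite coprime2n /=; lia.
Qed.

Lemma prefix_mkseq (b b' : nat -> bool) (l m : nat) : l <= m ->
  reflect (forall j, j < l -> b j = b' j) (prefix (mkseq b l) (mkseq b' m)).
Proof.
move=> lm; rewrite prefixE size_mkseq /mkseq -map_take take_iota (minn_idPl lm).
apply: (iffP eqP) => [h j jl|h].
  by have := congr1 (fun s => nth false s j) h; rewrite !(nth_map 0) ?size_iota ?nth_iota.
by apply/eq_in_map => j; rewrite mem_iota => jl; rewrite h.
Qed.

(** The block holds at most one digit 1, at [2 * block_start c k + 2 - 2 * m]; the bounds on [m] and
    [c] keep this position inside the block. *)
Lemma nat_of_bits_block_end (n c : nat) (b : nat -> bool) (i k m : nat) (u : seq bool)
    (j : nat) :
  task k = Some (u, j, m) -> 2 * m <= block_start c k -> 3 <= c ->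
  nat_of_bits (digit n c b i) (block_end c k) =
  nat_of_bits (digit n c b i) (block_start c k) * 2 ^ (block_start c k + c) +
  ((i == j) && prefix u (mkseq b (n * free_rank c (block_start c k))))
    * 2 ^ (c - 3 + 2 * m).
Proof.
move=> tk mk c3; have := @digit_block n c b i k.
have : block_end c k = (block_start c k).*2 + c by [].
rewrite /marked tk; move: (digit n c b i) => d.
move: (prefix u (mkseq b (n * free_rank c (block_start c k)))) => pre.
move: (block_end c k) (block_start c k) mk => e a mk eE dE.
case: (boolP ((i == j) && pre)) => hs; last first.
  rewrite mul0n addn0 (@nat_of_bits_zeros _ a e); first by congr (_ * 2 ^ _); lia.
    by lia.
  move=> q hq; rewrite dE //; apply/negP => /and3P[h1 _ h2].
  by rewrite h1 h2 in hs.
pose q0 := a.*2 + 2 - 2 * m.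
have z1 : nat_of_bits d q0 = nat_of_bits d a * 2 ^ (q0 - a).
  apply: nat_of_bits_zeros => [|q hq]; first by rewrite /q0; lia.
  by rewrite dE; [apply/negP => /and3P[_]; lia | lia].
have z2 : nat_of_bits d e = nat_of_bits d q0.+1 * 2 ^ (e - q0.+1).
  apply: nat_of_bits_zeros => [|q hq]; first by rewrite /q0; lia.
  by rewrite dE; [apply/negP => /and3P[_]; lia | lia].
have dq0 : d q0.
  rewrite dE; last by lia.
  by case/andP: hs => -> ->; rewrite andbT; apply/eqP; lia.
rewrite z2 /= z1 dq0.
have -> : c - 3 + 2 * m = e - q0.+1 by rewrite /q0; lia.
have -> : a + c = (q0 - a).+1 + (e - q0.+1) by rewrite /q0; lia.
by rewrite expnD expnS; nia.
Qed.

Local Open Scope classical_set_scope.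
Local Open Scope ring_scope.

(** * Real numbers and their binary digits *)

Definition binary (R : realType) (d : nat -> bool) : R :=
  limn (fun m => (nat_of_bits d m)%:R / 2 ^+ m : R).

Lemma natr_nat_of_bits (R : realType) (d : nat -> bool) (m : nat) :
  (nat_of_bits d m.+1)%:R = 2 * (nat_of_bits d m)%:R + (d m)%:R :> R.
Proof. by rewrite /= natrD -mul2n natrM. Qed.

Lemma binary_bounds (R : realType) (d : nat -> bool) (m : nat) :
  (nat_of_bits d m)%:R / 2 ^+ m <= binary R d <= ((nat_of_bits d m)%:R + 1) / 2 ^+ m.
Proof.
pose u m : R := (nat_of_bits d m)%:R / 2 ^+ m.
pose v m : R := ((nat_of_bits d m)%:R + 1) / 2 ^+ m.
have p2 k : 0 < 2 ^+ k :> R by rewrite exprn_gt0.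
have d01 k : (0 : R) <= (d k)%:R <= (1 : R) by case: (d k); rewrite ler01 lexx.
have u_nd : nondecreasing_seq u.
  apply/nondecreasing_seqP => k; rewrite -subr_ge0.
  have -> : u k.+1 - u k = (d k)%:R / (2 * 2 ^+ k).
    by rewrite /u natr_nat_of_bits exprS; field; rewrite gt_eqF.
  by case/andP: (d01 k) => h _; rewrite divr_ge0 // mulr_ge0 // ltW.
have v_ni : nonincreasing_seq v.
  apply/nonincreasing_seqP => k; rewrite -subr_ge0.
  have -> : v k - v k.+1 = (1 - (d k)%:R) / (2 * 2 ^+ k).
    by rewrite /v natr_nat_of_bits exprS; field; rewrite gt_eqF.
  by case/andP: (d01 k) => _ h; rewrite divr_ge0 ?subr_ge0 // mulr_ge0 // ltW.
have uv k l : u k <= v l.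
  have uv0 j : u j <= v j by rewrite ler_pM2r ?invr_gt0 // lerDl.
  case: (leqP k l) => kl; first exact: le_trans (u_nd _ _ kl) (uv0 _).
  exact: le_trans (uv0 _) (v_ni _ _ (ltnW kl)).
have cu : cvgn u.
  by apply: nondecreasing_is_cvgn => //; exists (v 0%N) => _ [k _ <-].
apply/andP; split; first exact: (nondecreasing_cvgn_le u_nd cu).
by apply: limr_le => //; near=> k; exact: uv.
Unshelve. all: by end_near. Qed.

(** A zero at position [m] leaves only the lower half of the dyadic interval, hence a gap between
    the intervals of different prefixes. *)
Lemma binary_bounds_zero (R : realType) (d : nat -> bool) (m : nat) : d m = false ->
  (nat_of_bits d m)%:R / 2 ^+ m <= binary R d <= ((nat_of_bits d m)%:R + 2^-1) / 2 ^+ m.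
Proof.
move=> dm; have /andP[-> _] := binary_bounds R d m.
have /andP[_] := binary_bounds R d m.+1; rewrite natr_nat_of_bits dm addr0.
have p2 : 2 ^+ m != 0 :> R by rewrite expf_neq0.
by rewrite exprS; congr (_ <= _); field.
Qed.

Lemma binary_close (R : realType) (d d' : nat -> bool) (m : nat) :
  nat_of_bits d m = nat_of_bits d' m -> `|binary R d - binary R d'| <= 2^-1 ^+ m.
Proof.
move=> e; have := binary_bounds R d m; have := binary_bounds R d' m; rewrite e exprVn.
rewrite mulrDl mul1r ler_norml; lra.
Qed.

(* The zero digit at position [m] rules out that two close numbers are
   separated by a carry. *)
Lemma binary_separated (R : realType) (d d' : nat -> bool) (m : nat) :
  d m = false -> d' m = false -> `|binary R d - binary R d'| < 2^-1 ^+ m.+1 ->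
  forall q, (q < m)%N -> d q = d' q.
Proof.
move=> dm dm' h; apply: nat_of_bits_inj; apply/eqP.
have := binary_bounds_zero R dm; have := binary_bounds_zero R dm'.
have p2 : 0 < 2 ^+ m :> R by rewrite exprn_gt0.
rewrite !ler_pdivrMr // !ler_pdivlMr //.
have : `|binary R d * 2 ^+ m - binary R d' * 2 ^+ m| < 2^-1.
  by rewrite -mulrBl normrM (gtr0_norm p2) -ltr_pdivlMr // -exprVn -exprS.
rewrite ltr_norml; set a := nat_of_bits d m; set a' := nat_of_bits d' m => h1 h2 h3.
have : a%:R < a'%:R + 1 :> R by lra.
have : a'%:R < a%:R + 1 :> R by lra.
rewrite !natr1 !ltr_nat; lia.
Qed.

Definition bits (R : realType) (t : R) (j : nat) : bool :=
  odd (Num.truncn (t * 2 ^+ j.+1)).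

Lemma nat_of_bits_bits (R : realType) (t : R) (m : nat) : 0 <= t < 1 ->
  nat_of_bits (bits t) m = Num.truncn (t * 2 ^+ m).
Proof.
case/andP=> t0 t1; elim: m => [|m IH] /=.
  by rewrite mulr1; apply/esym/truncn_def; rewrite t0 t1.
rewrite IH; set x := t * 2 ^+ m; have x0 : 0 <= x by rewrite mulr_ge0 // exprn_ge0.
rewrite /bits (_ : t * 2 ^+ m.+1 = 2 * x); last by rewrite exprS mulrCA.
have := truncn_itv x0; have /truncn_itv : 0 <= 2 * x by lra.
move: (Num.truncn x) (Num.truncn (2 * x)) => a a' /andP[h1 h2] /andP[h3 h4].
(* The integer part of [2 * x] is [2 * a] or [2 * a + 1], and [bits] records its parity. *)
suff : (a'./2 == a) by move=> /eqP; lia.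
have : (a' < a.*2.+2)%N.
  rewrite -(ltr_nat R) (le_lt_trans h1) // -doubleS -mul2n natrM; lra.
have : (a.*2 < a'.+1)%N.
  rewrite -(ltr_nat R) (le_lt_trans _ h2) // -mul2n natrM; lra.
lia.
Qed.

Lemma bits_close (R : realType) (t t' : R) (m : nat) : 0 <= t < 1 -> 0 <= t' < 1 ->
  (forall j, (j < m)%N -> bits t j = bits t' j) -> `|t - t'| <= 2^-1 ^+ m.
Proof.
move=> t01 t01' /eq_nat_of_bits; rewrite !nat_of_bits_bits // => e.
have p2 : 0 < 2 ^+ m :> R by rewrite exprn_gt0.
have [[t0 _] [t0' _]] := (andP t01, andP t01').
have /truncn_itv : 0 <= t * 2 ^+ m by rewrite mulr_ge0 // ltW.
have /truncn_itv : 0 <= t' * 2 ^+ m by rewrite mulr_ge0 // ltW.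
rewrite e -natr1 exprVn => h1 h2; rewrite -[_^-1]mul1r ler_pdivlMr //.
rewrite -[X in _ * X](gtr0_norm p2) -normrM mulrBl ler_norml; lra.
Qed.

(** * The points of the set and the non-vanishing of their inner products *)

Definition digit_point (R : realType) (n : nat) (b : nat -> bool) : 'rV[R]_n :=
  \row_i binary R (digit n (n + 4) b i).

Lemma digit_pointE (R : realType) (n : nat) (b : nat -> bool) (i : 'I_n) :
  digit_point R n b ord0 i = binary R (digit n (n + 4) b i).
Proof. exact: mxE. Qed.

Lemma coordB (R : realType) (n : nat) (u v : 'rV[R]_n) (i : 'I_n) :
  (u - v) ord0 i = u ord0 i - v ord0 i.
Proof. by rewrite !mxE. Qed.

Lemma digit_pointB (R : realType) (n : nat) (b b' : nat -> bool) (i : 'I_n) :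
  (digit_point R n b - digit_point R n b') ord0 i
  = binary R (digit n (n + 4) b i) - binary R (digit n (n + 4) b' i).
Proof.
rewrite (coordB (digit_point R n b)); apply: congr2; first exact: digit_pointE.
by congr (- _); exact: digit_pointE.
Qed.

Lemma binary01 (R : realType) (d : nat -> bool) : 0 <= binary R d <= 1.
Proof. by have := binary_bounds R d 0; rewrite /= expr0 !divr1 add0r. Qed.

(** This is [nat_of_bits_block_end] divided by [2^c]: the coordinate, scaled by [2^(2 p)], is a
    multiple of [2^p] plus the possible shift [4^m / 8], and the digits after the block account for
    the error. *)
Lemma binary_block (R : realType) (n c : nat) (b : nat -> bool) (i k m : nat)
    (u : seq bool) (j : nat) :
  task k = Some (u, j, m) -> (2 * m <= block_start c k)%N -> (3 <= c)%N ->
  0 <= binary R (digit n c b i) * (2 ^+ block_start c k) ^+ 2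
       - (nat_of_bits (digit n c b i) (block_start c k))%:R * 2 ^+ block_start c k
       - ((i == j) && prefix u (mkseq b (n * free_rank c (block_start c k))))%:R
         * (4 ^+ m / 8)
    <= 2^-1 ^+ c.
Proof.
move=> tk mk c3; have := binary_bounds R (digit n c b i) (block_end c k).
rewrite (nat_of_bits_block_end n b i tk mk c3) /block_end natrD !natrM.
set s := (i == j) && _; move: s (binary _ _) (nat_of_bits _ _) => s x A.
move: (block_start c k) => a.
have -> : (2 ^ (c - 3 + 2 * m))%:R = 2 ^+ c * (4 ^+ m / 8) :> R.
  rewrite -[in RHS](subnK c3).
  rewrite natrX [in LHS]exprD [in RHS]exprD exprM (_ : 2 ^+ 2 = 4 :> R); last by ring.
  by field.
have -> : ((2 ^ (a + c))%:R : R) = 2 ^+ a * 2 ^+ c by rewrite natrX exprD.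
have -> : (2 ^+ (a.*2 + c) : R) = (2 ^+ a) ^+ 2 * 2 ^+ c by rewrite -muln2 exprD exprM.
rewrite exprVn; have : 0 < 2 ^+ c :> R by rewrite exprn_gt0.
have : 0 < 2 ^+ a :> R by rewrite exprn_gt0.
move: (2 ^+ a) (2 ^+ c) (4 ^+ m / 8) => X Y t X0 Y0.
have XY : 0 < X ^+ 2 * Y by rewrite mulr_gt0 // exprn_gt0.
have E : A%:R * X + s%:R * t =
    (A%:R * (X * Y) + s%:R * (Y * t)) / (X ^+ 2 * Y) * X ^+ 2.
  by field; rewrite !gt_eqF.
have E' : Y^-1 = 1 / (X ^+ 2 * Y) * X ^+ 2 by field; rewrite !gt_eqF.
rewrite [(_ + 1) / _]mulrDl => /andP[]; have X2 : 0 < X ^+ 2 by rewrite exprn_gt0.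
rewrite -(ler_pM2r X2) -[x <= _](ler_pM2r X2) -E => h1.
rewrite mulrDl -E -E' => h2; apply/andP; split; lra.
Qed.

Lemma dist_le (R : realType) (x y e : R) : 0 <= x <= e -> 0 <= y <= e -> `|x - y| <= e.
Proof. by rewrite ler_norml; lra. Qed.

(** Splits the scaled product into an integral part, the effect of the shift [d], and errors. Using
    exact values in one factor and truncated ones in the other avoids a second-order error term. *)
Lemma lattice_product (R : realType) (x1 x2 x3 x4 a1 a2 a3 a4 d X : R) : X != 0 ->
  (x1 - x2) * (x3 - x4) * X ^+ 2 =
  (a1 - a2) * (a3 - a4) + d * (x3 - x4)
  + ((x1 * X ^+ 2 - a1 * X - d - (x2 * X ^+ 2 - a2 * X)) * (x3 - x4)
     + (a1 / X - a2 / X) * (x3 * X ^+ 2 - a3 * X - (x4 * X ^+ 2 - a4 * X))).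
Proof. by move=> X0; field. Qed.

Lemma intr_norm_lt1 (R : realType) (K : int) : `|K%:~R : R| < 1 -> K = 0.
Proof. by rewrite -intr_norm (_ : 1 = 1%:~R :> R) // ltr_int; lia. Qed.

(* With [X = 2^p]: up to errors of order [X^-2], the points are in the lattice
   [X^-1 Z^n], so that the products sum up to a multiple of [X^-2]; the shift of
   the first point by [t X^-2] in direction [j] moves that sum away from this
   lattice, by more than the errors can compensate. *)
Lemma lattice_sum_neq0 (R : realType) (n : nat) (j : 'I_n) (X t e : R)
    (A1 A2 A3 A4 : 'I_n -> nat) (x1 x2 x3 x4 : 'I_n -> R) :
  0 < X -> n%:R * (2 * e) < 8^-1 ->
  (forall i, [/\ 0 <= (A1 i)%:R / X <= 1 & 0 <= (A2 i)%:R / X <= 1]) ->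
  (forall i, [/\ 0 <= x3 i <= 1 & 0 <= x4 i <= 1]) ->
  (forall i, [/\ 0 <= x1 i * X ^+ 2 - (A1 i)%:R * X - (i == j)%:R * t <= e,
               0 <= x2 i * X ^+ 2 - (A2 i)%:R * X <= e,
               0 <= x3 i * X ^+ 2 - (A3 i)%:R * X <= e
             & 0 <= x4 i * X ^+ 2 - (A4 i)%:R * X <= e]) ->
  8^-1 <= `|t * (x3 j - x4 j)| < 2^-1 ->
  \sum_i (x1 i - x2 i) * (x3 i - x4 i) != 0.
Proof.
move=> X0 en A_bd x_bd r_bd tx.
pose K : int := \sum_i ((A1 i)%:Z - (A2 i)%:Z) * ((A3 i)%:Z - (A4 i)%:Z).
pose err i := (x1 i * X ^+ 2 - (A1 i)%:R * X - (i == j)%:R * t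
    - (x2 i * X ^+ 2 - (A2 i)%:R * X)) * (x3 i - x4 i)
  + ((A1 i)%:R / X - (A2 i)%:R / X)
    * (x3 i * X ^+ 2 - (A3 i)%:R * X - (x4 i * X ^+ 2 - (A4 i)%:R * X)).
have sumE : (\sum_i (x1 i - x2 i) * (x3 i - x4 i)) * X ^+ 2
    = K%:~R + t * (x3 j - x4 j) + \sum_i err i.
  have -> : t * (x3 j - x4 j) = \sum_i (i == j)%:R * t * (x3 i - x4 i).
    rewrite (bigD1 j) //= eqxx mul1r big1 ?addr0 // => i /negbTE->.
    by rewrite !mul0r.
  rewrite /K rmorph_sum -!big_split /= mulr_suml; apply: eq_bigr => i _.
  rewrite rmorphM !rmorphB /= -!pmulrn; apply: lattice_product.
  by rewrite gt_eqF.
have err_bd : `|\sum_i err i| < 8^-1.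
  apply: le_lt_trans en; apply: le_trans (ler_norm_sum _ _ _) _.
  have -> : n%:R * (2 * e) = \sum_(i < n) (e * 1 + 1 * e).
    by rewrite sumr_const card_ord -[RHS]mulr_natl; ring.
  apply: ler_sum => i _.
  have [[? ?] [? ?] [? ? ? ?]] := And3 (A_bd i) (x_bd i) (r_bd i).
  apply: le_trans (ler_normD _ _) _; rewrite !normrM.
  by apply: lerD; apply: ler_pM => //; exact: dist_le.
clear A_bd x_bd r_bd; apply/eqP => d0; move: sumE; rewrite d0 mul0r.
move: (t * _) (\sum_i err i) tx err_bd => p q tx err_bd /esym/eqP.
rewrite -addrA addr_eq0 => /eqP KE.
(* The integer [K] would have absolute value below 1/2 + 1/8; once it is 0, [|p| = |q|] contradicts
   [8^-1 <= |p|] and [|q| < 8^-1]. *)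
have K0 : K = 0.
  apply: (@intr_norm_lt1 R); rewrite KE normrN.
  apply: le_lt_trans (ler_normD _ _) _; lra.
have : `|p| = `|q| by rewrite -normrN; congr (`|_|); move: KE; rewrite K0; lra.
lra.
Qed.

(** Only the first point carries the mark of block [k], so [lattice_sum_neq0] applies with shift
    [t = 4^m / 8]; the condition on [m] is the required range of [t * (x3 j - x4 j)]. *)
Lemma dot_digit_point_neq0 (R : realType) (n : nat) (b1 b2 b3 b4 : nat -> bool)
    (k m : nat) (u : seq bool) (j : 'I_n) :
  let agrees b := prefix u (mkseq b (n * free_rank (n + 4) (block_start (n + 4) k))) in
  task k = Some (u, j : nat, m) -> (2 * m <= block_start (n + 4) k)%N ->
  agrees b1 -> ~~ agrees b2 -> ~~ agrees b3 -> ~~ agrees b4 ->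
  1 <= 4 ^+ m * `|(digit_point R n b3 - digit_point R n b4) ord0 j| < 4 ->
  dot (digit_point R n b1 - digit_point R n b2)
      (digit_point R n b3 - digit_point R n b4) != 0.
Proof.
move=> agrees tk mk p1 p2 p3 p4 hm.
pose x b (i : 'I_n) : R := binary R (digit n (n + 4) b i).
pose A b (i : 'I_n) := nat_of_bits (digit n (n + 4) b i) (block_start (n + 4) k).
have c3 : (3 <= n + 4)%N by rewrite addn4.
have r_bd b (i : 'I_n) := binary_block R n b i tk mk c3.
have X0 : 0 < 2 ^+ block_start (n + 4) k :> R by rewrite exprn_gt0.
have A_bd b i : 0 <= (A b i)%:R / 2 ^+ block_start (n + 4) k <= (1 : R).
  rewrite divr_ge0 ?ler0n ?(ltW X0) //= ler_pdivrMr // mul1r.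
  by rewrite -natrX ler_nat ltnW // ltn_nat_of_bits.
have -> : dot (digit_point R n b1 - digit_point R n b2)
    (digit_point R n b3 - digit_point R n b4)
  = \sum_i (x b1 i - x b2 i) * (x b3 i - x b4 i).
  apply: eq_bigr => i _.
  apply: congr2; exact: digit_pointB.
apply: (@lattice_sum_neq0 R n j _ (4 ^+ m / 8) (2^-1 ^+ (n + 4))
  (A b1) (A b2) (A b3) (A b4) (x b1) (x b2) (x b3) (x b4) X0).
(* Here the margin [c = n + 4] matters: the total error is [(n / 2^n) / 8 < 1/8]. *)
- rewrite exprVn exprD.
  have : n%:R < 2 ^+ n :> R by rewrite -natrX ltr_nat ltn_expl.
  have : 0 < 2 ^+ n :> R by rewrite exprn_gt0.
  move: (2 ^+ n) (n%:R) => y z y0 zy.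
  rewrite (_ : _ * _ = z / y / 8); last by field; rewrite gt_eqF.
  by rewrite -[ltRHS]mul1r ltr_pM2r ?invr_gt0 // ltr_pdivrMr // mul1r.
- by move=> i; split; exact: A_bd.
- by move=> i; split; exact: binary01.
- move=> i; split.
  + by have := r_bd b1 i; rewrite -/(agrees b1) p1 andbT val_eqE.
  + by have := r_bd b2 i; rewrite -/(agrees b2) (negbTE p2) andbF mul0r subr0.
  + by have := r_bd b3 i; rewrite -/(agrees b3) (negbTE p3) andbF mul0r subr0.
  + by have := r_bd b4 i; rewrite -/(agrees b4) (negbTE p4) andbF mul0r subr0.
have t0 : 0 <= 4 ^+ m :> R by rewrite exprn_ge0.
move: hm; rewrite (digit_pointB R b3 b4 j) -/(x b3 j) -/(x b4 j) normrM.
rewrite (ger0_norm (divr_ge0 t0 _)) //.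
by rewrite mulrAC; move: (_ * `|_|) => q; lra.
Qed.

Definition digit_set (R : realType) (n : nat) : set 'rV[R]_n := range (@digit_point R n).

Lemma exists_lt_exp2 (R : realType) (x : R) : exists k, x < 2 ^+ k.
Proof.
exists (Num.truncn x).+1; apply: lt_le_trans (truncnS_gt x) _.
by rewrite -natrX ler_nat ltnW // ltn_expl.
Qed.

Lemma half_expr_lt (R : realType) (e : R) : 0 < e -> exists k, 2^-1 ^+ k < e.
Proof.
move=> e0; have [k hk] := exists_lt_exp2 e^-1; exists k.
by rewrite exprVn -[ltRHS]invrK ltf_pV2 ?posrE ?invr_gt0 ?exprn_gt0.
Qed.

Lemma exists_expr4_itv (R : realType) (w : R) : 0 < w <= 1 ->
  exists m : nat, 1 <= 4 ^+ m * w < 4.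
Proof.
case/andP=> w0 w1; have hex : exists m, 1 <= 4 ^+ m * w.
  have [k hk] := half_expr_lt w0; exists k.
  have p2 : 1 <= 2 ^+ k :> R by rewrite exprn_ege1 // ler1n.
  have : 4 ^+ k = 2 ^+ k * 2 ^+ k :> R by rewrite -exprMn; congr (_ ^+ _); ring.
  move: hk p2; rewrite exprVn -[_^-1]mul1r ltr_pdivrMr ?exprn_gt0 //.
  move: (2 ^+ k) (4 ^+ k) => y x h1 h2 ->; nra.
case: (ex_minnP hex) => -[|m] hm mmin.
  by exists 0%N; rewrite hm /= mul1r; lra.
exists m.+1; rewrite hm exprS /=; have : 4 ^+ m * w < 1.
  by rewrite ltNge; apply/negP => /mmin; rewrite ltnn.
lra.
Qed.

(** The point [y] may equal [z] or [v]: with [y = v] as vertex, this also excludes right angles. *)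
Lemma dot_digit_set_neq0 (R : realType) (n : nat) (x y z v : 'rV[R]_n) :
  digit_set x -> digit_set y -> digit_set z -> digit_set v ->
  x != y -> x != z -> x != v -> z != v -> dot (x - y) (z - v) != 0.
Proof.
move=> [b1 _ <-] [b2 _ <-] [b3 _ <-] [b4 _ <-] n12 n13 n14 n34.
have diff b : digit_point R n b1 != digit_point R n b -> exists l, b1 l != b l.
  move=> h; apply: contrapT => /forallNP h'; move/eqP: h; apply.
  by congr digit_point; apply/funext => l; apply/eqP/negPn/negP/h'.
have [[l2 h2] [l3 h3] [l4 h4]] := And3 (diff _ n12) (diff _ n13) (diff _ n14).
have [j hj] : exists j, digit_point R n b3 ord0 j != digit_point R n b4 ord0 j.
  apply: contrapT => /forallNP h; move/eqP: n34; apply.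
  by apply/rowP => j; apply/eqP/negPn/negP/h.
pose w := `|(digit_point R n b3 - digit_point R n b4) ord0 j|.
have [m hm] : exists m : nat, 1 <= 4 ^+ m * w < 4.
  apply: exists_expr4_itv; rewrite /w (digit_pointB R b3 b4 j) normr_gt0 subr_eq0.
  move: hj; rewrite !digit_pointE => -> /=; apply: dist_le; exact: binary01.
(* The first [L] bits distinguish [b1] from the other three sequences. *)
pose L := (maxn l2 (maxn l3 l4)).+1.
have [K hK] := free_rank_unbounded (n + 4) L.
(* Beyond [K], at least [L] bits precede the block; beyond [2 * m], the mark falls inside it. *)
have [k kK tk] := task_recurrent (mkseq b1 L, nat_of_ord j, m) (maxn K (2 * m)).
have n0 : (0 < n)%N by exact: leq_ltn_trans (ltn_ord j).
have LM : (L <= n * free_rank (n + 4) (block_start (n + 4) k))%N.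
  apply: leq_trans (leq_pmull _ n0); apply: hK.
  exact: leq_trans (leq_maxl _ _) kK.
have disagree b l : (l < L)%N -> b1 l != b l ->
    ~~ prefix (mkseq b1 L) (mkseq b (n * free_rank (n + 4) (block_start (n + 4) k))).
  by move=> lL h; apply/negP => /(prefix_mkseq _ _ LM)/(_ l lL)/eqP; rewrite (negbTE h).
apply: (dot_digit_point_neq0 tk) => //.
- apply: ltnW; apply: leq_ltn_trans (ltn_block_start (n + 4) k).
  exact: leq_trans (leq_maxr _ _) kK.
- exact/prefix_mkseq.
- by apply: disagree h2; rewrite ltnS leq_maxl.
- by apply: disagree h3; rewrite ltnS !leq_max leqnn orbT.
- by apply: disagree h4; rewrite ltnS !leq_max leqnn !orbT.
Qed.

(** * Right angles and inner products *)

Lemma dotvv_gt0 (R : realType) (n : nat) (u : 'rV[R]_n) : u != 0 -> 0 < dot u u.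
Proof.
move=> u0; have [j hj] : exists j, u ord0 j != 0.
  apply: contrapT => /forallNP h; move/eqP: u0; apply.
  by apply/rowP => j; rewrite mxE; apply/eqP/negPn/negP/h.
rewrite /dot (bigD1 j) //= ltr_pwDl //; first by rewrite -expr2 exprn_even_gt0.
by apply: sumr_ge0 => i _; rewrite -expr2 sqr_ge0.
Qed.

(** Cauchy-Schwarz: [dot v v] times the gap is the squared length of [(v . v) u - (u . v) v]. *)
Lemma sqr_dot_le (R : realType) (n : nat) (u v : 'rV[R]_n) : v != 0 ->
  dot u v ^+ 2 <= dot u u * dot v v.
Proof.
move=> /dotvv_gt0 v0; rewrite -subr_ge0 -(pmulr_rge0 _ v0).
have -> : dot v v * (dot u u * dot v v - dot u v ^+ 2)
  = \sum_i (dot v v * u ord0 i - dot u v * v ord0 i) ^+ 2.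
  transitivity (\sum_i (dot v v ^+ 2 * (u ord0 i * u ord0 i)
    - 2 * dot v v * dot u v * (u ord0 i * v ord0 i)
    + dot u v ^+ 2 * (v ord0 i * v ord0 i))).
    rewrite big_split /= sumrB -!mulr_sumr.
    rewrite -/(dot u u) -/(dot u v) -/(dot v v); ring.
  by apply: eq_bigr => i _; ring.
by apply: sumr_ge0 => i _; rewrite sqr_ge0.
Qed.

Lemma angle_pihalf (R : realType) (n : nat) (y x z : 'rV[R]_n) : y != x -> z != x ->
  angle y x z = pi / 2 -> dot (y - x) (z - x) = 0.
Proof.
rewrite -![_ == x]subr_eq0 /angle; move: (y - x) (z - x) => u v u0 v0 h.
have [u1 v1] := (dotvv_gt0 u0, dotvv_gt0 v0).
have uv : 0 < enorm u * enorm v by rewrite mulr_gt0 // sqrtr_gt0.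
(* [acos] inverts [cos] only on this interval, whence the use of Cauchy-Schwarz. *)
have /acosK : dot u v / (enorm u * enorm v) \in `[(-1), 1].
  rewrite in_itv /= -ler_norml normrM normfV (gtr0_norm uv) ler_pdivrMr // mul1r.
  rewrite -ler_sqr ?nnegrE ?(ltW uv) // exprMn !sqr_sqrtr ?(ltW u1) ?(ltW v1) //.
  by rewrite real_normK ?num_real // sqr_dot_le.
rewrite h cos_pihalf => /esym/eqP; rewrite mulf_eq0 invr_eq0 (gt_eqF uv) orbF.
by move/eqP.
Qed.

(** * Compactness, as a continuous image of the Cantor space *)

Lemma digit_point_close (R : realType) (n k : nat) (b b' : nat -> bool) (i : 'I_n) :
  (forall l, (l < n * free_rank (n + 4) (block_start (n + 4) k))%N -> b l = b' l) ->
  `|digit_point R n b ord0 i - digit_point R n b' ord0 i| <= 2^-1 ^+ block_end (n + 4) k.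
Proof.
move=> h; rewrite !digit_pointE; apply: binary_close; apply: eq_nat_of_bits.
exact: digit_local.
Qed.

Lemma digit_point_continuous (R : realType) (n : nat) :
  continuous (digit_point R n : cantor_space -> 'rV[R]_n).
Proof.
move=> b; apply/cvg_ballP => e e0; have [k hk] := half_expr_lt e0.
have hkk : (k <= block_end (n + 4) k)%N.
  by have := ltn_block_start (n + 4) k; rewrite /block_end; lia.
pose M := (n * free_rank (n + 4) (block_start (n + 4) k))%N.
have hb : \forall b' \near (b : cantor_space), forall l, (l < M)%N -> b l = b' l.
  elim: M => [|M IH]; first by near=> b'.
  have hM : \forall b' \near (b : cantor_space), b' M = b M.
    have /= := @proj_continuous nat (fun=> bool) M b [set b M].
    by apply; exact: discrete_set1.
  near=> b' => l; rewrite ltnS leq_eqVlt => /orP[/eqP->|].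
    by apply/esym; near: b'.
  by move: l; near: b'.
near=> b'; split=> // i j; rewrite /ball /= ord1; apply: le_lt_trans hk.
apply: le_trans (_ : 2^-1 ^+ block_end (n + 4) k <= _); last first.
  by apply: ler_wiXn2l => //; rewrite ?invr_ge0 // invf_le1 // ler1n.
by apply: digit_point_close; near: b'.
Unshelve. all: by end_near. Qed.

Lemma digit_set_compact (R : realType) (n : nat) : compact (@digit_set R n).
Proof.
apply: (continuous_compact _ cantor_space_compact).
by apply: continuous_subspaceT; exact: digit_point_continuous.
Qed.

(** * Upper bound for the dimension *)

Lemma half_expr_powR (R : realType) (k : nat) (s : R) :
  (2^-1 ^+ k) `^ s = 2 `^ (- (k%:R * s)).
Proof. by rewrite exprVn -powR_mulrn // -powRN -powRrM mulNr. Qed.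

Lemma half_expr_le (R : realType) (k l : nat) : (k <= l)%N ->
  2^-1 ^+ l <= 2^-1 ^+ k :> R.
Proof. by apply: ler_wiXn2l; rewrite ?invr_ge0 // invf_le1 // ler1n. Qed.

Lemma coord_le_enorm (R : realType) (n : nat) (u : 'rV[R]_n) (i : 'I_n) :
  `|u ord0 i| <= enorm u.
Proof.
rewrite /enorm -sqrtr_sqr ler_wsqrtr // /dot (bigD1 i) //= expr2 lerDl.
by apply: sumr_ge0 => j _; rewrite -expr2 sqr_ge0.
Qed.

Lemma enorm_le (R : realType) (n : nat) (u : 'rV[R]_n) (e : R) : 0 <= e ->
  (forall i, `|u ord0 i| <= e) -> enorm u <= n%:R * e.
Proof.
move=> e0 h; have ne0 : 0 <= n%:R * e by rewrite mulr_ge0.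
rewrite /enorm -(ger0_norm ne0) -sqrtr_sqr ler_wsqrtr // /dot.
apply: (@le_trans _ _ (\sum_(i < n) e * e)).
  by apply: ler_sum => i _; rewrite -expr2 -real_normK ?num_real // expr2 ler_pM.
rewrite sumr_const card_ord -[_ *+ n]mulr_natl exprMn -expr2 ler_wpM2r ?sqr_ge0 //.
by rewrite -natrX ler_nat; nia.
Qed.

Lemma diam_pow_ge0 (R : realType) (n : nat) (s : R) (A : set 'rV[R]_n) :
  (0 <= diam_pow s A)%E.
Proof. by rewrite /diam_pow; case: ifP => // _; exact: poweR_ge0. Qed.

Lemma enorm_le_diam (R : realType) (n : nat) (A : set 'rV[R]_n) (x y : 'rV[R]_n) :
  A x -> A y -> ((enorm (x - y))%:E <= diam A)%E.
Proof. by move=> Ax Ay; apply: ereal_sup_ubound; exists x => //; exists y. Qed.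

Lemma diam_ge0 (R : realType) (n : nat) (A : set 'rV[R]_n) :
  A !=set0 -> (0 <= diam A)%E.
Proof.
by move=> [x Ax]; apply: le_trans (enorm_le_diam Ax Ax); rewrite lee_fin sqrtr_ge0.
Qed.

Lemma diam_pow_le (R : realType) (n : nat) (s d : R) (A : set 'rV[R]_n) :
  0 <= s -> 0 <= d -> (diam A <= d%:E)%E -> (diam_pow s A <= (d `^ s)%:E)%E.
Proof.
move=> s0 d0 h; rewrite /diam_pow; case: eqP => [_|/eqP/set0P A0].
  by rewrite lee_fin powR_ge0.
rewrite -poweR_EFin; apply: gt0_ler_poweR => //.
  by rewrite in_itv /= diam_ge0 // leey.
by rewrite in_itv /= lee_fin d0 leey.
Qed.

Lemma hausdorff_premeasure_ge0 (R : realType) (n : nat) (s delta : R)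
  (A : set 'rV[R]_n) : (0 <= hausdorff_premeasure s delta A)%E.
Proof.
apply: le_ereal_inf_tmp => _ [U _ <-]; apply: nneseries_ge0 => i _ _.
exact: diam_pow_ge0.
Qed.

(* The level [k] pieces: prefixes of [n * free_rank _ <= n * block_start] bits
   give that many sets of diameter at most [2^-(2 * block_start)]. *)
Lemma hausdorff_measure_digit_set0 (R : realType) (n : nat) (s : R) :
  n%:R / 2 < s -> hausdorff_measure s (@digit_set R n) = 0%E.
Proof.
move=> ns; have s0 : 0 <= s by apply: le_trans (ltW ns); rewrite divr_ge0.
suff h delta : 0 < delta -> hausdorff_premeasure s delta (@digit_set R n) = 0%E.
  apply/eqP; rewrite eq_le; apply/andP; split.
    by apply/ereal_supP => _ [d /= d0 <-]; rewrite h.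
  by apply: le_ereal_sup_tmp; exists 0%E => //; exists 1 => //=; rewrite h.
move=> delta0; apply/eqP; rewrite eq_le hausdorff_premeasure_ge0 andbT.
apply/lee_addgt0Pr => eps eps0; rewrite add0e.
(* At most [2^(n a)] pieces of diameter at most [2^-(2 a)] contribute at most [theta^a]. *)
pose theta : R := 2 `^ (n%:R - 2 * s).
have theta0 : 0 <= theta by exact: powR_ge0.
have theta1 : theta < 1.
  rewrite /theta /powR pnatr_eq0 /= -[ltRHS]expR0 ltr_expR.
  rewrite pmulr_llt0 ?ln_gt0 ?ltr1n //; lra.
have [k1 hk1] := half_expr_lt delta0.
have [k2 hk2] : exists k2, forall k, (k2 <= k)%N -> theta ^+ k < eps.
  have : (theta ^+ x @[x --> \oo] --> 0) by apply: cvg_expr; rewrite ger0_norm.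
  move=> /cvgrPdist_lt/(_ _ eps0)[k2 _ h]; exists k2 => k hk.
  by have := h k hk; rewrite sub0r normrN ger0_norm // exprn_ge0.
set c := (n + 4)%N; pose k := maxn k1 k2; pose a := block_start c k.
have ka : (k <= a)%N by rewrite /a ltnW // ltn_block_start.
pose M := (n * free_rank c a)%N.
pose U i := [set digit_point R n b | b in [set b | nat_of_bits b M = i]].
pose rho : R := 2^-1 ^+ a.*2.
have rho0 : 0 <= rho by rewrite exprn_ge0 // invr_ge0.
have diamU i : (diam (U i) <= rho%:E)%E.
  apply/ereal_supP => _ [_ [b /= bi <-] [_ [b' /= b'i <-] <-]]; rewrite lee_fin.
  have eb := nat_of_bits_inj (etrans bi (esym b'i)).
  apply: (@le_trans _ _ (n%:R * 2^-1 ^+ block_end c k)).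
    apply: enorm_le => [|j]; first by rewrite exprn_ge0 // invr_ge0.
    by have := digit_point_close R j eb; rewrite !mxE.
  (* The factor [n] from comparing norms is absorbed by [2^-c]. *)
  rewrite /rho /block_end exprD mulrCA ler_piMr //.
  rewrite exprVn ler_pdivrMr ?exprn_gt0 // mul1r -natrX ler_nat.
  by rewrite (leq_trans (ltnW (ltn_expl n (ltnSn 1)))) // leq_exp2l // /c leq_addr.
apply: (@le_trans _ _ (\sum_(0 <= i <oo) diam_pow s (U i))%E).
  apply: ereal_inf_lbound; exists U => //; split=> [_ [b _ <-]|i].
    by exists (nat_of_bits b M) => //; exists b.
  apply: le_trans (diamU i) _; rewrite lee_fin (le_trans _ (ltW hk1)) //.
  by apply: half_expr_le; move: ka; rewrite /k; lia.
rewrite (nneseries_split 0%N (2 ^ M)%N) ?add0n; last by move=> *; exact: diam_pow_ge0.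
rewrite [X in (_ + X)%E]eseries0 ?adde0; last first.
  move=> i iM _; rewrite /diam_pow; case: eqP => // /eqP/set0P[_ [b /= bi _]].
  by have := ltn_nat_of_bits b M; rewrite bi ltnNge iM.
apply: (@le_trans _ _ (\sum_(0 <= i < 2 ^ M) (rho `^ s)%:E)%E).
  by apply: lee_sum => i _; exact: diam_pow_le.
rewrite sumEFin lee_fin big_const_nat subn0 iter_addr_0.
apply: le_trans (ltW (hk2 a _)); last by move: ka; rewrite /k; lia.
rewrite -[leLHS]mulr_natl natrX.
apply: (@le_trans _ _ (2 ^+ (n * a) * rho `^ s)).
  rewrite ler_wpM2r ?powR_ge0 // ler_weXn2l ?ler1n // leq_mul2l.
  rewrite /free_rank; have := count_size (is_free c) (iota 0 a); rewrite size_iota => ->.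
  by rewrite orbT.
rewrite /rho half_expr_powR -!powR_mulrn // -powRD ?pnatr_eq0 ?implybT //.
rewrite /theta -powRrM natrM -muln2 natrM; apply: ler_powR; first by rewrite ler1n.
lra.
Qed.

(** * Lower bound for the dimension *)

Lemma free_rank_density (R : realType) (n c : nat) (s : R) : s < n%:R / 2 ->
  exists K : R, 2 * s <= K /\ forall r, s * (2 * r.+1%:R ^+ 2 + 2) <=
     (n * free_rank c (2 * r ^ 2).+1)%:R + K.
Proof.
move=> sn; pose eta : R := n%:R / 2 - s; have eta0 : 0 < eta by rewrite subr_gt0.
have n0 : 0 <= n%:R :> R by []. have c0 : 0 <= c%:R :> R by [].
have q0 : 0 <= (25 / 8) * n%:R ^+ 2 / eta.
  by rewrite divr_ge0 ?(ltW eta0) // mulr_ge0 // sqr_ge0.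
(* The first term is the maximum of [5 n r - 2 eta r^2] over real [r]: the quadratic gain from
   [s < n / 2] beats the linear losses. *)
exists ((25 / 8) * n%:R ^+ 2 / eta + 2 * n%:R + n%:R * (c%:R + 1) / 2); split.
  have : 0 <= n%:R * (c%:R + 1) / 2 :> R by rewrite divr_ge0 // mulr_ge0 // addr_ge0.
  lra.
move=> r; have := free_rank_ge c r; set F := free_rank _ _ => hF.
have {}hF : 2 * r%:R ^+ 2 <= 2 * F%:R + 6 * r%:R + c%:R + 1 :> R.
  move: hF; rewrite -(ler_nat R) (natrM _ 2 (r ^ 2)) natrX.
  by rewrite (natrD _ _ 1) (natrD _ _ c) (natrD _ (2 * F)) (natrM _ 2 F) (natrM _ 6 r).
have r0 : 0 <= r%:R :> R by [].
have hq : 5 * n%:R * r%:R - 2 * eta * r%:R ^+ 2 <= 25 / 8 * n%:R ^+ 2 / eta.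
  rewrite -subr_ge0 (_ : _ - _ = 2 / eta * (eta * r%:R - 5 / 4 * n%:R) ^+ 2).
    by rewrite mulr_ge0 ?sqr_ge0 // divr_ge0 // ltW.
  by field; rewrite gt_eqF.
have hn : n%:R * (2 * r%:R ^+ 2) <= n%:R * (2 * F%:R + 6 * r%:R + c%:R + 1) :> R.
  exact: ler_wpM2l.
have er0 : 0 <= eta * r%:R by rewrite mulr_ge0 // ltW.
have -> : s = n%:R / 2 - eta by rewrite /eta; ring.
rewrite natrM -[r.+1]addn1 natrD.
clear q0; move: n%:R r%:R F%:R c%:R (25 / 8 * _ / _)
  hn hq eta0 er0 => N x f C Q; clearbody eta.
lra.
Qed.

Lemma leq_sqr2 (r : nat) : (r <= (2 * r ^ 2).+1)%N.
Proof. nia. Qed.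

(** Bit [l] sits in coordinate [l %% n], at the free position of rank [l %/ n]; the spacer zero
    excludes carries. *)
Lemma digit_point_separated (R : realType) (n r : nat) (b b' : nat -> bool) :
  (forall i : 'I_n, `|digit_point R n b ord0 i - digit_point R n b' ord0 i|
                    < 2^-1 ^+ (2 * r ^ 2).+2) ->
  forall l, (l < n * free_rank (n + 4) (2 * r ^ 2).+1)%N -> b l = b' l.
Proof.
move=> close l hl; have n0 : (0 < n)%N by move: hl; case: (n).
have /free_rank_onto[q [qp fq rq]] : (l %/ n < free_rank (n + 4) (2 * r ^ 2).+1)%N.
  by rewrite ltn_divLR // mulnC.
pose i := Ordinal (ltn_pmod l n0).
have := close i; rewrite (digit_pointE R b i) (digit_pointE R b' i).
move=> /(binary_separated (digit_spacer _ _ _ _ _) (digit_spacer _ _ _ _ _))/(_ q qp).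
by rewrite /digit fq rq /= mulnC -divn_eq.
Qed.

Lemma digit_point_holder (R : realType) (n : nat) (s : R) :
  (0 < n)%N -> 0 <= s < n%:R / 2 -> exists2 C : R, 0 < C &
  forall t t' d : R, 0 <= t < 1 -> 0 <= t' < 1 -> 0 <= d ->
  (forall i : 'I_n, `|digit_point R n (bits t) ord0 i
                 - digit_point R n (bits t') ord0 i| <= d) ->
  `|t - t'| <= C * d `^ s.
Proof.
move=> n0 /andP[s0 sn]; have [K [K0 hK]] := free_rank_density (n + 4) sn.
exists (2 `^ K); first by rewrite powR_gt0.
move=> t t' d t01 t'01 d0 close.
have key r : d < 2^-1 ^+ (2 * r ^ 2).+2 ->
    `|t - t'| <= 2^-1 ^+ (n * free_rank (n + 4) (2 * r ^ 2).+1).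
  move=> dr; apply: bits_close => //; apply: (@digit_point_separated R) => i.
  exact: le_lt_trans (close i) dr.
have C0 : 0 <= 2 `^ K * d `^ s by rewrite mulr_ge0 // powR_ge0.
(* For [d = 0] there is no scale to choose; instead all bits agree. *)
have [d00|d_neq0] := eqVneq d 0.
  suff -> : t = t' by rewrite subrr normr0.
  apply: contrapT => tt'; have : 0 < `|t - t'| by rewrite normr_gt0 subr_eq0; exact/eqP.
  move=> /half_expr_lt[k]; rewrite ltNge => /negP; apply.
  have [M hM] := free_rank_unbounded (n + 4) k.
  pose r := block_start (n + 4) M.
  have rk : (k <= n * free_rank (n + 4) (2 * r ^ 2).+1)%N.
    apply: leq_trans (leq_pmull _ n0); apply: leq_trans (hM M (leqnn _)) _.
    by apply: leq_free_rank; exact: leq_sqr2.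
  apply: le_trans (key r _) (half_expr_le R rk).
  by rewrite d00 exprn_gt0 // invr_gt0.
have {}d_gt0 : 0 < d by rewrite lt_neqAle eq_sym d_neq0.
have low k : 2^-1 ^+ k <= d -> 2 `^ (K - k%:R * s) <= 2 `^ K * d `^ s.
  move=> kd; rewrite powRD ?pnatr_eq0 ?implybT // ler_wpM2l ?powR_ge0 //.
  rewrite -half_expr_powR; apply: ge0_ler_powR => //.
  by rewrite nnegrE exprn_ge0 // invr_ge0.
have hex : exists r, 2^-1 ^+ (2 * r ^ 2).+2 <= d.
  have [k hk] := half_expr_lt d_gt0; exists k; apply: le_trans (ltW hk).
  by apply: half_expr_le; apply: leq_trans (leq_sqr2 k) _; exact: leqnSn.
(* At the least scale [r = 0] the trivial bound 1 suffices, as [2 * s <= K]. Otherwise [d] is below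
   the threshold of the preceding spacer, and [hK] compares the number of common bits with the
   exponent of the next one. *)
case: (ex_minnP hex) => -[|r] hr rmin; apply: le_trans (low _ hr).
  apply: (@le_trans _ _ 1).
    by move: t01 t'01 => /andP[? ?] /andP[? ?]; rewrite ler_norml; lra.
  rewrite -[leLHS](powRr0 2); apply: ler_powR; first by rewrite ler1n.
  by rewrite subr_ge0.
apply: le_trans (key r _) _.
  by rewrite ltNge; apply/negP => /rmin; rewrite ltnn.
rewrite -[leLHS]powRr1 ?exprn_ge0 ?invr_ge0 // half_expr_powR mulr1.
apply: ler_powR; first by rewrite ler1n.
have := hK r; rewrite mulrC.
have -> : (2 * r.+1 ^ 2).+2%:R = 2 * r.+1%:R ^+ 2 + 2 :> R.
  by rewrite -addn2 natrD (natrM _ 2 (r.+1 ^ 2)) natrX.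
lra.
Qed.

(** A cover of the set pulls back along [t -> digit_point (bits t)] to a cover of [[0, 1)] by sets
    of diameter at most [C * diam^s]; comparing Lebesgue measures bounds every sum below by
    [1 / (2 C)]. *)
Lemma hausdorff_measure_digit_set_neq0 (R : realType) (n : nat) (s : R) :
  (0 < n)%N -> 0 <= s < n%:R / 2 -> hausdorff_measure s (@digit_set R n) <> 0%E.
Proof.
move=> n0 hs; have [C C0 holder] := digit_point_holder n0 hs.
move=> H0; have : (hausdorff_premeasure s 1 (@digit_set R n) < (2 * C)^-1%:E)%E.
  apply: (@le_lt_trans _ _ 0%E); last by rewrite lte_fin invr_gt0 mulr_gt0.
  rewrite -H0; apply: ereal_sup_ubound; exists 1 => //=.
case/ereal_inf_lt => _ [U [Ucov Udiam] <-].
apply/negP; rewrite -leNgt.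
pose T i := [set t : R | 0 <= t < 1 /\ U i (digit_point R n (bits t))].
pose rho i := C * fine (diam_pow s (U i)).
have dp_fin i : diam_pow s (U i) \is a fin_num.
  rewrite ge0_fin_numE ?diam_pow_ge0 //.
  by apply: le_lt_trans (diam_pow_le _ ler01 (Udiam i)) (ltry _); case/andP: hs.
have rho0 i : 0 <= rho i by rewrite mulr_ge0 ?(ltW C0) // fine_ge0 // diam_pow_ge0.
have Tdist i t t' : T i t -> T i t' -> `|t - t'| <= rho i.
  move=> [t01 Ut] [t'01 Ut'].
  have U0 : U i !=set0 by exists (digit_point R n (bits t)).
  have d0 := diam_ge0 U0.
  have dfin : diam (U i) \is a fin_num.
    by rewrite ge0_fin_numE // (le_lt_trans (Udiam i)) // ltry.
  rewrite /rho /diam_pow (negbTE (proj2 (set0P _) U0)) -(fineK dfin) poweR_EFin /=.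
  apply: holder => // [|j]; first exact: fine_ge0.
  rewrite -coordB; apply: le_trans (coord_le_enorm _ _) _.
  by rewrite -lee_fin fineK // enorm_le_diam.
(* The sets [U i] are arbitrary, so [T i] may fail to be measurable; it is enclosed in an interval
   around one of its points. *)
pose F i : set R := if pselect (T i !=set0) is left h
  then `[proj1_sig (cid h) - rho i, proj1_sig (cid h) + rho i]%classic else set0.
have Fm i : measurable (F i) by rewrite /F; case: pselect.
have TF i : T i `<=` F i.
  move=> t Tt; rewrite /F; case: pselect => [h|]; last by case; exists t.
  case: cid => t0 /= Tt0; have := Tdist _ _ _ Tt Tt0.
  by rewrite /= in_itv /= ler_norml; lra.
have Fmeas i : (lebesgue_measure (F i) <= (2 * C)%:E * diam_pow s (U i))%E.
  have -> : ((2 * C)%:E * diam_pow s (U i) = (2 * rho i)%:E)%E.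
    by rewrite -(fineK (dp_fin i)) -EFinM /rho mulrA.
  rewrite /F; case: pselect => [h|_]; last first.
    by rewrite measure0 lee_fin mulr_ge0.
  rewrite lebesgue_measure_itv /=; case: ifP => _; last by rewrite lee_fin mulr_ge0.
  by rewrite -EFinB lee_fin; lra.
have : (1%:E <= \sum_(0 <= i <oo) lebesgue_measure (F i))%E.
  have -> : 1%:E = lebesgue_measure (`[0, 1[%classic : set R).
    by rewrite lebesgue_measure_itv /= lte_fin ltr01 sube0.
  apply: measure_sigma_subadditive => //.
  move=> t /=; rewrite in_itv /= => t01.
  have [i _ Ui] := Ucov (digit_point R n (bits t)) (ex_intro2 _ _ _ I erefl).
  by exists i => //; apply: TF.
have hle : (\sum_(0 <= i <oo) lebesgue_measure (F i)
    <= (2 * C)%:E * \sum_(0 <= i <oo) diam_pow s (U i))%E.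
  rewrite -nneseriesZl; last by move=> i _; exact: diam_pow_ge0.
  by apply: lee_nneseries => // i _ _; exact: measure_ge0.
move=> /le_trans/(_ hle); rewrite muleC -lee_pdivrMr ?mulr_gt0 //.
by rewrite mul1e.
Qed.

(** * The dimension and the conclusion *)

Lemma hausdorff_dim_digit_set (R : realType) (n : nat) : (0 < n)%N ->
  hausdorff_dim (@digit_set R n) = (n%:R / 2)%:E.
Proof.
move=> n0; apply/eqP; rewrite eq_le; apply/andP; split.
  apply/lee_addgt0Pr => e e0; apply: ereal_inf_lbound; exists (n%:R / 2 + e) => //.
  split; first by rewrite addr_ge0 ?divr_ge0 // ltW.
  by apply: hausdorff_measure_digit_set0; rewrite ltrDl.
apply: le_ereal_inf_tmp => _ [s [s0 Hs] <-]; rewrite lee_fin leNgt.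
by apply/negP => sn; apply: (hausdorff_measure_digit_set_neq0 n0 _ Hs); rewrite s0.
Qed.

Theorem theorem3p1 (R : realType) (n : nat) (hn : (2 <= n)%N) :
  exists E : set 'rV[R]_n,
    [/\ compact E,
        hausdorff_dim E = (n%:R / 2)%:E,
        ~ (exists x y z : 'rV[R]_n,
             [/\ E x, E y, E z & form_angle (pi / 2) x y z])
      & ~ (exists x y z v : 'rV[R]_n,
             [/\ E x, E y, E z & E v] /\
             uniq [:: x; y; z; v] /\ orthogonal_vec (x - y) (z - v))].
Proof.
exists (@digit_set R n); split.
- exact: digit_set_compact.
- exact: hausdorff_dim_digit_set (ltnW hn).
- move=> [x [y [z [Ex Ey Ez [uxyz [a [b [c [abc angle_bac]]]]]]]]].
  have mem w : w \in [:: a; b; c] -> digit_set w.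
    by rewrite (perm_mem abc) !inE => /or3P[] /eqP->.
  move: uxyz; rewrite -(perm_uniq abc) /= !inE negb_or.
  move=> /andP[/andP[ab ac] /andP[bc _]].
  have dot0 : dot (b - a) (c - a) = 0 by apply: angle_pihalf; rewrite // eq_sym.
  have /eqP := dot0; apply/negP; apply: dot_digit_set_neq0 => //;
    by [apply: mem; rewrite !inE eqxx ?orbT | rewrite eq_sym].
- move=> [x [y [z [v [[Ex Ey Ez Ev] [u /eqP]]]]]]; apply/negP.
  move: u; rewrite /= !inE !negb_or => /and4P[/and3P[xy xz xv] _ zv _].
  exact: dot_digit_set_neq0.
Qed.
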